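(* Let $\sigma\in M^0_{\rho,\Lambda}(\mathbb{T}\times\mathbb{Z})$. Then for all compact operators $K$ on $L^2(\mathbb{T})$, $$\|T_\sigma-K\|_*\ge d,\qquad\text{where}\quad d=\limsup_{|k|\to\infty}\Big\{\sup_{x\in[-\pi,\pi]}|\sigma(x,k)|\Big\},$$ and $\|\cdot\|_*$ denotes the norm in the $C^*$-algebra of all bounded linear operators on $L^2(\mathbb{T})$.
   Context: $\mathbb{N}_0=\{0,1,2,\dots\}$, and $\mathbb{T}=\mathbb{R}/2\pi\mathbb{Z}$ is the one-dimensional torus, identified with $[-\pi,\pi]$ with endpoints identified. For a function $a$ of $k\in\mathbb{Z}$, $\Delta_k a(k)=a(k+1)-a(k)$ and $\Delta_k^\alpha$ is its $\alpha$-th iterate. Weight function: $\Lambda:\mathbb{Z}\to(0,\infty)$ is a fixed function for which there are positive constants $\mu_0\le\mu_1$, $C_0,C_1$ with $C_0(1+|k|)^{\mu_0}\le\Lambda(k)\le C_1(1+|k|)^{\mu_1}$ for all $k\in\mathbb{Z}$. Moreover there is a real constant $\mu\ge\mu_1$ such that for all $\alpha\in\mathbb{N}_0$ and $\gamma\in\{0,1\}$ there is $C_{\alpha,\gamma}>0$ with $|k^\gamma\Delta_k^{\alpha+\gamma}\Lambda(k)|\le C_{\alpha,\gamma}\Lambda(k)^{1-\alpha/\mu}$ for all $k\in\mathbb{Z}$. Fix $\rho\in(0,1/\mu]$. Symbol classes: for $m\in\mathbb{R}$, $S^m_{\rho,\Lambda}(\mathbb{T}\times\mathbb{Z})$ is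 the set of functions $\sigma:\mathbb{T}\times\mathbb{Z}\to\mathbb{C}$, smooth in $x$ for every $k\in\mathbb{Z}$, such that for all $\alpha,\beta\in\mathbb{N}_0$ there is $C_{\alpha,\beta}>0$ with $|\Delta_k^\alpha\partial_x^\beta\sigma(x,k)|\le C_{\alpha,\beta}\Lambda(k)^{m-\rho\alpha}$ for all $(x,k)\in\mathbb{T}\times\mathbb{Z}$. $M^m_{\rho,\Lambda}(\mathbb{T}\times\mathbb{Z})$ is the set of functions $\sigma:\mathbb{T}\times\mathbb{Z}\to\mathbb{C}$, smooth in $x$ for every $k$, such that $k^\gamma\Delta_k^\gamma\sigma(x,k)\in S^m_{\rho,\Lambda}(\mathbb{T}\times\mathbb{Z})$ for each $\gamma\in\{0,1\}$. The pseudo-differential operator with symbol $\sigma$ is $$T_\sigma f(x)=(2\pi)^{-1}\sum_{k\in\mathbb{Z}}\int_{\mathbb{T}}e^{i(x-y)k}\sigma(x,k)f(y)\,dy,\quad x\in\mathbb{T},\ f\in C^\infty(\mathbb{T}).$$ For $\sigma\in M^0_{\rho,\Lambda}(\mathbb{T}\times\mathbb{Z})$ it extends to a bounded linear operator on $L^2(\mathbb{T})$, still denoted $T_\sigma$. *)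

(* Defs.v *)
From HB Require Import structures.
From mathcomp Require Import all_boot all_order all_algebra generic_quotient.
From mathcomp Require Import ring_quotient.
From mathcomp Require Import all_classical all_reals all_analysis.
From mathcomp Require Import measurable_realfun.
From mathcomp.real_closed Require Import complex.

Set Implicit Arguments.
Unset Strict Implicit.
Unset Printing Implicit Defensive.

Import Order.TTheory GRing.Theory Num.Theory.
Import numFieldNormedType.Exports.
Import ComplexField.Normc.

Local Open Scope classical_set_scope.
Local Open Scope ring_scope.
Local Open Scope complex_scope.
Local Open Scope quotient_scope.

(* Functions on the torus are functions on R of period 2 * pi; integration over
   the torus is integration over [-pi, pi] for the Lebesgue measure. *)
Definition torus_measure (R : realType) : {measure set (measurableTypeR R) -> \bar R} :=
  mrestr (@lebesgue_measure R) (measurable_itv `[- pi, pi]).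

Section L2fun.
Variable R : realType.
Implicit Types f g : measurableTypeR R -> R[i].

Local Notation mu := (torus_measure R).

Definition L2norm_fun f : \bar R :=
  'N[mu]_2%:E [EFin \o (fun x => normc (f x))]%E.

Definition L2fun : {pred measurableTypeR R -> R[i]} := fun f =>
  `[< [/\ measurable_fun setT (fun x => complex.Re (f x)),
          measurable_fun setT (fun x => complex.Im (f x)) &
          (L2norm_fun f < +oo)%E] >].

Lemma normc_ge0 (z : R[i]) : 0 <= normc z.
Proof. by case: z => x y; exact: sqrtr_ge0. Qed.

Lemma ReD (z w : R[i]) : complex.Re (z + w) = complex.Re z + complex.Re w.
Proof. by case: z w => [? ?] []. Qed.

Lemma ImD (z w : R[i]) : complex.Im (z + w) = complex.Im z + complex.Im w.
Proof. by case: z w => [? ?] []. Qed.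

Lemma ReM (z w : R[i]) :
  complex.Re (z * w) = complex.Re z * complex.Re w - complex.Im z * complex.Im w.
Proof. by case: z w => [? ?] []. Qed.

Lemma ImM (z w : R[i]) :
  complex.Im (z * w) = complex.Re z * complex.Im w + complex.Im z * complex.Re w.
Proof. by case: z w => [? ?] []. Qed.

Let p1 : (1 <= 2%:E :> \bar R)%E.
Proof. by rewrite lee_fin ler1n. Qed.

Lemma L2fun_measurable_normc0 f :
  measurable_fun setT (fun x => complex.Re (f x)) ->
  measurable_fun setT (fun x => complex.Im (f x)) ->
  measurable_fun setT (fun x => normc (f x)).
Proof.
move=> mr mi.
rewrite (_ : (fun x => _) =
    Num.sqrt \o (fun x => complex.Re (f x) ^+ 2 + complex.Im (f x) ^+ 2)); last first.
  by apply/funext => x /=; case: (f x).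
apply: measurableT_comp.
  by apply: continuous_measurable_fun; exact: sqrt_continuous.
by apply: measurable_funD; apply: measurable_funX.
Qed.

Lemma L2fun_measurable_normc f : f \in L2fun ->
  measurable_fun setT (fun x => normc (f x)).
Proof. by move=> /asboolP[mr mi _]; exact: L2fun_measurable_normc0. Qed.

Lemma measurable_normc2 f : f \in L2fun ->
  measurable_fun setT (fun x => (`|(EFin \o (fun y => normc (f y))) x| `^ 2)%E).
Proof.
move=> /L2fun_measurable_normc mf; apply: (measurableT_comp (measurable_poweR _)).
by apply: measurableT_comp => //; exact/measurable_EFinP.
Qed.

Lemma L2norm_funZ (a : R[i]) f : f \in L2fun ->
  (L2norm_fun (a *: f)%R = (normc a)%:E * L2norm_fun f)%E.
Proof.
move=> fL2; have mn := L2fun_measurable_normc fL2.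
have nP : (fun x => normc (f x)) \in Lfun mu 2%:E.
  by move/asboolP: fL2 => -[_ _ fin]; rewrite inE; apply/andP; split; exact/mem_set.
have := LnormZ (Lfun_Sub p1 nP) (normc a).
rewrite (ger0_norm (normc_ge0 a)) => <-.
by apply: eq_Lnorm => x /=; rewrite normcM.
Qed.

Lemma L2norm_funD f g : f \in L2fun -> g \in L2fun ->
  (L2norm_fun (f + g)%R <= L2norm_fun f + L2norm_fun g)%E.
Proof.
move=> /[dup] fL2 /L2fun_measurable_normc mf /[dup] gL2 /L2fun_measurable_normc mg.
have mk := eminkowski mu mf mg p1.
rewrite /L2norm_fun; apply: le_trans mk.
rewrite unlock.
have mfg : measurable_fun setT (fun x => normc ((f + g) x)).
  apply: L2fun_measurable_normc0.
    rewrite (_ : (fun x => _) = (fun x => complex.Re (f x)) \+ (fun x => complex.Re (g x))).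
      by apply: measurable_funD; [case/asboolP: fL2|case/asboolP: gL2].
    by apply/funext => x; exact: ReD.
  rewrite (_ : (fun x => _) = (fun x => complex.Im (f x)) \+ (fun x => complex.Im (g x))).
    by apply: measurable_funD; [case/asboolP: fL2|case/asboolP: gL2].
  by apply/funext => x; exact: ImD.
have mE (h : measurableTypeR R -> R) : measurable_fun setT h ->
    measurable_fun setT (fun x => (`|(EFin \o h) x| `^ 2)%E).
  move=> mh; apply: (measurableT_comp (measurable_poweR _)).
  by apply: measurableT_comp => //; exact/measurable_EFinP.
apply: gt0_ler_poweR.
- by rewrite invr_ge0.
- by rewrite in_itv/= leey integral_ge0// => x _; exact: poweR_ge0.
- by rewrite in_itv/= leey integral_ge0// => x _; exact: poweR_ge0.
- apply: ge0_le_integral => //.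
  + by move=> x _; exact: poweR_ge0.
  + exact: mE.
  + by apply: mE; exact: measurable_funD.
  + move=> x _ /=; rewrite lee_fin.
    apply: ge0_ler_powR; rewrite ?nnegrE// ger0_norm ?normc_ge0//.
    by rewrite (le_trans (le_normcD _ _))// ler_norm.
Qed.

Lemma L2fun_submod_closed : submod_closed L2fun.
Proof.
split.
  apply/asboolP; split; [exact: measurable_cst|exact: measurable_cst|].
  rewrite /L2norm_fun (_ : _ \o _ = cst 0%E) ?Lnorm0//.
  by apply/funext => x; congr EFin; exact: normc0.
move=> a f g fL2 gL2.
suff afL2 : a *: f \in L2fun.
  apply/asboolP; case/asboolP: (afL2) => mr mi fin; case/asboolP: (gL2) => mr' mi' fin'.
  split.
  - rewrite (_ : (fun x => _) =
        (fun x => complex.Re ((a *: f) x)) \+ (fun x => complex.Re (g x))).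
      exact: measurable_funD.
    by apply/funext => x; exact: ReD.
  - rewrite (_ : (fun x => _) =
        (fun x => complex.Im ((a *: f) x)) \+ (fun x => complex.Im (g x))).
      exact: measurable_funD.
    by apply/funext => x; exact: ImD.
  - by apply: le_lt_trans (L2norm_funD afL2 gL2) _; rewrite lte_add_pinfty.
apply/asboolP; split.
- rewrite (_ : (fun x => _) = (fun x => complex.Re a * complex.Re (f x)) \-
      (fun x => complex.Im a * complex.Im (f x))).
    by case/asboolP: fL2 => mr mi _; apply: measurable_funB; apply: measurable_funM.
  by apply/funext => x; exact: ReM.
- rewrite (_ : (fun x => _) = (fun x => complex.Re a * complex.Im (f x)) \+
      (fun x => complex.Im a * complex.Re (f x))).
    by case/asboolP: fL2 => mr mi _; apply: measurable_funD; apply: measurable_funM.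
  by apply/funext => x; exact: ImM.
- rewrite L2norm_funZ// lte_mul_pinfty ?lee_fin ?normc_ge0//.
  by case/asboolP: fL2.
Qed.

HB.instance Definition _ := GRing.isSubmodClosed.Build _ _ L2fun L2fun_submod_closed.

Record L2pre := MkL2pre { L2pre_fun :> measurableTypeR R -> R[i] ; _ : L2pre_fun \in L2fun }.
HB.instance Definition _ := [isSub for L2pre_fun].
HB.instance Definition _ := [Choice of L2pre by <:].
HB.instance Definition _ := [SubChoice_isSubLmodule of L2pre by <:].

Definition L2null : {pred L2pre} := fun f : L2pre =>
  `[< (f : measurableTypeR R -> R[i]) = cst 0 %[ae mu] >].

Lemma L2null_submod_closed : submod_closed L2null.
Proof.
split; first by apply/asboolP; exact: aeW.
move=> a f g /asboolP f0 /asboolP g0; apply/asboolP.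
apply: filterS2 f0 g0 => x fx gx _.
rewrite [LHS]/(a * (f : _ -> _) x + (g : _ -> _) x) fx// gx//.
by change (a * 0 + 0 = 0 :> R[i]); rewrite mulr0 addr0.
Qed.

HB.instance Definition _ := GRing.isSubmodClosed.Build _ _ L2null L2null_submod_closed.

(* The values of a function outside [-pi, pi] do not matter for this quotient. *)
Definition L2torus : Type := {ideal_quot L2null}.
HB.instance Definition _ := GRing.Zmodule.on L2torus.
HB.instance Definition _ := EqQuotient.on L2torus.

Definition L2torus_fun (u : L2torus) : measurableTypeR R -> R[i] := repr u.
Coercion L2torus_fun : L2torus >-> Funclass.

Lemma L2torus_eqP (f g : L2pre) :
  reflect ((f : _ -> _) = g %[ae torus_measure R]) (f == g %[mod L2torus]).
Proof.
rewrite -Quotient.idealrBE; apply: (iffP (asboolP _)); apply: filterS => x.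
- by move=> /(_ I) /subr0_eq.
- by move=> fg _; exact: etrans (congr1 (fun z => z - (g : _ -> _) x) (fg I)) (subrr _).
Qed.

Lemma L2torus_pi (f : L2pre) : (\pi f : L2torus) = f %[ae torus_measure R].
Proof. by apply/L2torus_eqP; rewrite reprK. Qed.

Definition L2torus_scale (a : R[i]) := lift_op1 L2torus ( *:%R a).

Lemma pi_scale (a : R[i]) : {morph \pi_L2torus : f / a *: f >-> L2torus_scale a f}.
Proof.
move=> f; unlock L2torus_scale; apply/eqP/L2torus_eqP; apply: filterS (L2torus_pi f) => x fx _.
exact: (congr1 (fun z => a * z) (esym (fx I))).
Qed.

Let scaleA a b (u : L2torus) : L2torus_scale a (L2torus_scale b u) = L2torus_scale (a * b) u.
Proof. by elim/quotW: u => f; rewrite -!pi_scale scalerA. Qed.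

Let scale1 : left_id 1 L2torus_scale.
Proof. by elim/quotW => f; rewrite -pi_scale scale1r. Qed.

Let scaleDr : right_distributive L2torus_scale +%R.
Proof.
by move=> a; elim/quotW => f; elim/quotW => g; rewrite -raddfD -!pi_scale scalerDr raddfD.
Qed.

Let scaleDl (u : L2torus) : {morph L2torus_scale^~ u : a b / a + b}.
Proof. by move=> a b; elim/quotW: u => f; rewrite -!pi_scale scalerDl raddfD. Qed.

HB.instance Definition _ :=
  GRing.Zmodule_isLmodule.Build R[i] L2torus scaleA scale1 scaleDr scaleDl.

Definition L2norm (u : L2torus) : R := fine (L2norm_fun u).

Lemma L2normE (u : L2torus) : (L2norm u)%:E = L2norm_fun u.
Proof.
have /asboolP[_ _ fin] : (u : _ -> _) \in L2fun := valP (repr u).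
by rewrite fineK// fin_numElt fin (lt_le_trans ltNy0) ?Lnorm_ge0.
Qed.

Lemma L2norm_pi (f : L2pre) : L2norm_fun (\pi f : L2torus) = L2norm_fun f.
Proof.
rewrite /L2norm_fun unlock; congr poweR; apply: ge0_ae_eq_integral => //.
- by apply: measurable_normc2; exact: valP.
- by apply: measurable_normc2; exact: valP.
- by move=> x _; exact: poweR_ge0.
- by move=> x _; exact: poweR_ge0.
- by apply: filterS (L2torus_pi f) => x fx _ /=; rewrite fx.
Qed.

Lemma L2normD (u v : L2torus) : L2norm (u + v) <= L2norm u + L2norm v.
Proof.
rewrite -lee_fin EFinD !L2normE; elim/quotW: u => f; elim/quotW: v => g.
rewrite -raddfD !L2norm_pi.
by apply: L2norm_funD; exact: valP.
Qed.

Lemma L2normZ (a : R[i]) (u : L2torus) : L2norm (a *: u) = normc a * L2norm u.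
Proof.
apply/EFin_inj; rewrite EFinM !L2normE; elim/quotW: u => f; rewrite -[a *: _]pi_scale !L2norm_pi.
by apply: L2norm_funZ; exact: valP.
Qed.

Lemma L2norm_eq0 (u : L2torus) : L2norm u = 0 -> u = 0.
Proof.
move/eqP; rewrite -eqe => /eqP; rewrite L2normE => u0.
have mu1 : measurable_fun setT (EFin \o (fun x => normc (u x))).
  by apply/measurable_EFinP; apply: L2fun_measurable_normc; exact: valP.
have /(_ (lte0n 2)) := Lnorm_eq0_eq0 mu1 _ u0.
move=> ae0; rewrite -[u]reprK -[RHS](raddf0 \pi_L2torus).
apply/eqP/L2torus_eqP; apply: filterS ae0 => x /(_ I) [] nx0 _.
exact: eq0_normc nx0.
Qed.

Let normCD (u v : L2torus) : (L2norm (u + v))%:C <= (L2norm u)%:C + (L2norm v)%:C.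
Proof. by rewrite -rmorphD lecR L2normD. Qed.

Let normCZ (a : R[i]) (u : L2torus) : (L2norm (a *: u))%:C = `|a| * (L2norm u)%:C.
Proof. by rewrite L2normZ rmorphM; congr (_ * _); case: a. Qed.

Let normC_eq0 (u : L2torus) : (L2norm u)%:C = 0 -> u = 0.
Proof. by move=> [] /L2norm_eq0. Qed.

HB.instance Definition _ :=
  Lmodule_isNormed.Build R[i] L2torus normCD normCZ normC_eq0.
End L2fun.

(* As the scalars are complex, the norm of the normed module is a complex number;
   L2norm is the same norm as an element of R. *)
Lemma L2_normE (R : realType) (u : L2torus R) : `|u| = (L2norm u)%:C.
Proof. by []. Qed.

Definition bounded_operator (K : numFieldType) (V W : normedModType K) (A : V -> W) :=
  exists M : K, forall v, `|A v| <= M * `|v|.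

Definition compact_operator (K : numFieldType) (V W : normedModType K) (A : V -> W) :=
  forall B : set V, bounded_set B -> precompact (A @` B).

Definition operator_norm (R : realType) (A : L2torus R -> L2torus R) : \bar R :=
  ereal_sup [set (L2norm (A u))%:E | u in [set u | L2norm u <= 1]].

Section calculus.
Variable R : realType.

(* R[i] is not a normed module over R in the library, so derivatives, integrals
   and sums of complex-valued functions are taken componentwise. *)
Definition cderive1n (n : nat) (f : R -> R[i]) (x : R) : R[i] :=
  derive1n n (fun y => complex.Re (f y)) x +i* derive1n n (fun y => complex.Im (f y)) x.

Definition csmooth (f : R -> R[i]) := forall (n : nat) (x : R),
  derivable (derive1n n (fun y => complex.Re (f y))) x 1 /\
  derivable (derive1n n (fun y => complex.Im (f y))) x 1.

Definition torus_integral (f : R -> R[i]) : R[i] :=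
  (\int[torus_measure R]_y complex.Re (f y)) +i* (\int[torus_measure R]_y complex.Im (f y)).

Definition expi (t : R) : R[i] := cos t +i* sin t.

(* limit of the symmetric partial sums over -N <= k <= N *)
Definition sum_int (a : int -> R[i]) : R[i] :=
  let S N := \sum_(0 <= j < N.*2.+1) a (j%:Z - N%:Z) in
  limn (fun N => complex.Re (S N)) +i* limn (fun N => complex.Im (S N)).

(* elements of C^oo(T) *)
Definition torus_smooth (f : R -> R[i]) := periodic f (pi *+ 2) /\ csmooth f.

End calculus.

Definition Delta (V : zmodType) (a : int -> V) (k : int) : V := a (k + 1) - a k.

Section symbols.
Variable R : realType.
Implicit Types (Lam : int -> R) (m mu rho : R) (sigma : R -> int -> R[i]).

Definition weight_function Lam mu :=
  [/\ forall k, 0 < Lam k,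
      exists mu0 mu1 C0 C1 : R,
        [/\ 0 < mu0 <= mu1, mu1 <= mu, 0 < C0, 0 < C1 &
            forall k : int, C0 * (1 + `|k|%:~R) `^ mu0 <= Lam k <= C1 * (1 + `|k|%:~R) `^ mu1] &
      forall a g : nat, (g <= 1)%N -> exists2 C : R, 0 < C &
        forall k : int, `|k%:~R ^+ g * iter (a + g) (@Delta R) Lam k| <= C * Lam k `^ (1 - a%:R / mu)].

Definition symbol_S Lam rho m sigma :=
  (forall k, torus_smooth (sigma^~ k)) /\
  forall a b : nat, exists2 C : R, 0 < C &
    forall (x : R) (k : int),
      normc (iter a (@Delta R[i]) (fun l => cderive1n b (sigma^~ l) x) k) <=
      C * Lam k `^ (m - rho * a%:R).

Definition symbol_M Lam rho m sigma :=
  (forall k, torus_smooth (sigma^~ k)) /\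
  forall g : nat, (g <= 1)%N ->
    symbol_S Lam rho m (fun x k => k%:~R ^+ g * iter g (@Delta R[i]) (sigma x) k).

Definition pdo sigma (f : R -> R[i]) (x : R) : R[i] :=
  ((pi *+ 2)^-1)%:C *
  sum_int (fun k => torus_integral (fun y => expi ((x - y) * k%:~R) * sigma x k * f y)).

(* As C^oo(T) is dense in L^2(T), at most one bounded T satisfies this. *)
Definition extends_pdo sigma (T : L2torus R -> L2torus R) :=
  forall (f : R -> R[i]) (u : L2torus R), torus_smooth f ->
    u = f %[ae torus_measure R] -> T u = pdo sigma f %[ae torus_measure R].

(* limsup as |k| --> +oo *)
Definition limsup_abs (s : int -> \bar R) : \bar R :=
  ereal_inf [set ereal_sup [set s k | k in [set k : int | (N <= `|k|)%N]] | N in [set: nat]].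

Definition limsup_symbol sigma : \bar R :=
  limsup_abs (fun k => ereal_sup [set (normc (sigma x k))%:E | x in `[- pi, pi]]).

End symbols.

(* Main.v *)
Require Import Defs.
From mathcomp Require Import all_boot all_order all_algebra generic_quotient.
From mathcomp Require Import all_classical all_reals all_analysis.
From mathcomp Require Import measurable_realfun ring lra zify.
From mathcomp.real_closed Require Import complex.

Import Order.TTheory GRing.Theory Num.Theory.
Import numFieldNormedType.Exports.
Import ComplexField.Normc.
Local Open Scope classical_set_scope.
Local Open Scope ring_scope.
Local Open Scope complex_scope.
Local Open Scope quotient_scope.

(** The norm of [T - K] is bounded below by showing that [sigma x0 k] is an
    approximate eigenvalue of [T] when [|k|] is large, with an approximate
    eigenvector on which [K] is small.

    Write [e_m x = exp (i m x)].  Since [T e_m = sigma(., m) e_m]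
    ([pdo_expi_L2]), [T] is explicit on trigonometric polynomials, and the test
    vector is [u = sum_(j < N) exp (-i j x0) e_(k+j)], that is, [e_k] times a
    Dirichlet kernel [D] centred at [x0].  Then [T u - sigma(x0, k) u] is the sum
    of two terms.  The first one, [(sigma(., k) - sigma(x0, k)) u], is bounded
    uniformly in [N]: the bound on the first derivative in [x] gives
    [|sigma(x, k) - sigma(x0, k)| <= L |1 - exp (i (x - x0))|], where periodicity
    lets the length of the chord replace the distance ([symbol_chord]), and
    multiplying [D] by [1 - exp (i (x - x0))] telescopes to
    [1 - exp (i N (x - x0))], of modulus at most [2] ([dirichlet_chord]).  The
    second one collects the differences [sigma(x, k+j) - sigma(x, k)], which tend
    to [0] uniformly in [x] as [|k|] grows because they are
    [O(Lambda(k) ^ (-rho))] and [Lambda] is unbounded ([symbol_slow]).  As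
    [||u|| = sqrt (2 pi) sqrt N] by Parseval ([L2norm_lincomb]), the error is
    [O(1 / sqrt N)] relative to [u] ([test_vector_eigen]).

    A compact operator sends [e_m] to [0] as [|m|] tends to infinity
    ([compact_operator_expi]): otherwise, by compactness, [K e_m] stays close to
    one nonzero vector for infinitely many [m], and the sum of [n] such
    exponentials has norm of order [sqrt n] and an image of norm of order [n].

    If the norm of [T - K] is [r] and [r < d < limsup], one can take [|k|]
    arbitrarily large and [x0] with [d < |sigma(x0, k)|], whence
    [d ||u|| <= r ||u|| + O(1)], which is absurd for large [N]. *)

Set Implicit Arguments.
Unset Strict Implicit.
Unset Printing Implicit Defensive.

(** * Complex exponentials *)

Section trig.
Variable R : realType.
Implicit Types (x y t c : R) (m : int).

Lemma expiD x y : expi (x + y) = expi x * expi y.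
Proof. by rewrite /expi cosD sinD; congr (_ +i* _); rewrite addrC (mulrC (sin x)). Qed.

Lemma expi0 : expi (0 : R) = 1.
Proof. by rewrite /expi cos0 sin0. Qed.

Lemma normc_expi t : normc (expi t) = 1.
Proof. by rewrite /= cos2Dsin2 sqrtr1. Qed.

Lemma expiMn t n : expi (t *+ n) = expi t ^+ n.
Proof. by elim: n => [|n IH]; rewrite ?mulr0n ?expi0// mulrS exprS expiD IH. Qed.

Lemma normc_expiX t n : normc (expi t ^+ n) = 1.
Proof. by rewrite -expiMn normc_expi. Qed.

Lemma expi2pi_int m : expi (pi *+ 2 * m%:~R : R) = 1.
Proof.
have e n : expi (pi *+ 2 * n%:R : R) = 1.
  by rewrite mulr_natr expiMn /expi cos2pi sin2pi expr1n.
case: m => n; first exact: e.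
rewrite NegzE rmorphN mulrN.
have /eqP := expiD (pi *+ 2 * n.+1%:R) (- (pi *+ 2 * n.+1%:R) : R).
by rewrite subrr e expi0 mul1r eq_sym => /eqP.
Qed.

(** Functions of the form [a cos (c x) + b sin (c x)] are the real form of the
    multiples of exponentials, and they form a family stable under derivation, so
    each analytic fact is needed only once. *)
Lemma is_derive_trig (a b c x : R) :
  is_derive x 1 (fun y => a * cos (y * c) + b * sin (y * c))
    (b * c * cos (x * c) + - (a * c) * sin (x * c)).
Proof.
have dc : is_derive x 1 (fun y : R => y * c) c.
  rewrite (_ : (fun y => y * c) = (fun y : R => c *: y)); last first.
    by apply/funext => y; rewrite mulrC.
  by apply: is_derive_eq; rewrite /= scaler1.
have d1 : is_derive x 1 (fun y : R => cos (y * c)) (- sin (x * c) * c).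
  exact: (is_derive1_comp (f := cos)).
have d2 : is_derive x 1 (fun y : R => sin (y * c)) (cos (x * c) * c).
  exact: (is_derive1_comp (f := sin)).
have := is_deriveD (is_deriveZ a d1) (is_deriveZ b d2).
move=> h; apply: (is_derive_eq h); rewrite /GRing.scale /=; ring.
Qed.

Lemma continuous_trig (a b c : R) :
  continuous (fun y : R => a * cos (y * c) + b * sin (y * c)).
Proof.
move=> x; apply/differentiable_continuous/derivable1_diffP.
by have [] := is_derive_trig a b c x.
Qed.

Lemma derive1n_trig (a b c : R) n : exists a' b', 
  derive1n n (fun y : R => a * cos (y * c) + b * sin (y * c)) =
  (fun y => a' * cos (y * c) + b' * sin (y * c)).
Proof.
elim: n => [|n [a' [b' IH]]]; first by exists a, b.
exists (b' * c), (- (a' * c)); rewrite derive1nS IH; apply/funext => x.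
by rewrite derive1E; apply: derive_val; exact: is_derive_trig.
Qed.

Lemma torus_smooth_expi m : torus_smooth (fun x : R => expi (x * m%:~R)).
Proof.
split=> [x|n x]; first by rewrite mulrDl expiD expi2pi_int mulr1.
split.
- have [a [b h]] := derive1n_trig 1 0 m%:~R n.
  rewrite (_ : (fun y => _) = (fun y : R => 1 * cos (y * m%:~R) + 0 * sin (y * m%:~R))).
    by rewrite h; have [] := is_derive_trig a b m%:~R x.
  by apply/funext => y /=; rewrite mul1r mul0r addr0.
- have [a [b h]] := derive1n_trig 0 1 m%:~R n.
  rewrite (_ : (fun y => _) = (fun y : R => 0 * cos (y * m%:~R) + 1 * sin (y * m%:~R))).
    by rewrite h; have [] := is_derive_trig a b m%:~R x.
  by apply/funext => y /=; rewrite mul1r mul0r add0r.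
Qed.

(** * Integration over the torus *)

Lemma torus_measureT : torus_measure R setT = (pi *+ 2)%:E.
Proof.
rewrite /torus_measure/= /mrestr setTI lebesgue_measure_itv/= lte_fin.
by rewrite gtrN ?pi_gt0// -EFinD opprK mulr2n.
Qed.

Lemma bounded_integrable_torus (f : R -> R) M : measurable_fun setT f ->
  (forall x, `|f x| <= M) ->
  (torus_measure R).-integrable setT (EFin \o f).
Proof.
move=> mf fM; apply: measurable_bounded_integrable => //.
- by apply: (le_lt_trans (y := (pi *+ 2)%:E)); rewrite ?ltry// torus_measureT.
- by exists M; split; rewrite ?num_real// => y My x _; apply: le_trans (fM x) (ltW My).
Qed.

(** Boundedness gives integrability for the finite measure [torus_measure], which
    allows the null set outside [[-pi, pi]] to be discarded. *)
Lemma integral_torus (f : R -> R) M : measurable_fun setT f ->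
  (forall x, `|f x| <= M) ->
  (\int[torus_measure R]_x (f x)%:E = \int[lebesgue_measure]_(x in `[(- pi)%R, pi]) (f x)%:E)%E.
Proof.
move=> mf fM.
have mD : measurable (`[- pi, pi] : set (measurableTypeR R)) by exact: measurable_itv.
rewrite [LHS](@negligible_integral _ _ _ (torus_measure R) setT (~` `[- pi, pi]) (EFin \o f)) //.
- rewrite setTD setCK; apply: eq_measure_integral => A mA AD.
  by rewrite /torus_measure/= /mrestr; congr (_ _); apply/setIidl.
- exact: measurableC.
- exact: (bounded_integrable_torus mf fM).
- by rewrite /torus_measure/= /mrestr setICl measure0.
Qed.

Lemma normr_trig_le (a b t : R) : `|a * cos t + b * sin t| <= `|a| + `|b|.
Proof.
apply: le_trans (ler_normD _ _) _; rewrite !normrM.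
by apply: lerD; rewrite ler_piMr// ler_norml ?cos_geN1 ?cos_le1 ?sin_geN1 ?sin_le1.
Qed.

Lemma measurable_trig (a b c : R) :
  measurable_fun setT (fun y : R => a * cos (y * c) + b * sin (y * c)).
Proof. by apply: continuous_measurable_fun; exact: continuous_trig. Qed.

Lemma integrable_trig (a b c : R) : (torus_measure R).-integrable setT
  (EFin \o (fun y : R => a * cos (y * c) + b * sin (y * c))).
Proof.
apply: (@bounded_integrable_torus _ (`|a| + `|b|)); first exact: measurable_trig.
by move=> x; exact: normr_trig_le.
Qed.

Lemma Rintegral_trig (a b : R) m :
  \int[torus_measure R]_y (a * cos (y * m%:~R) + b * sin (y * m%:~R)) =
  if m == 0 then pi *+ 2 * a else 0.
Proof.
case: eqVneq => [->|m0].
  under eq_Rintegral do rewrite mulr0 cos0 sin0 mulr0 addr0 mulr1.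
  by rewrite Rintegral_cst// torus_measureT mulrC.
rewrite /Rintegral (@integral_torus _ (`|a| + `|b|)); last 2 first.
- exact: measurable_trig.
- by move=> x; exact: normr_trig_le.
have m0R : m%:~R != 0 :> R by rewrite intr_eq0.
pose F y : R := - (b / m%:~R) * cos (y * m%:~R) + a / m%:~R * sin (y * m%:~R).
rewrite (@continuous_FTC2 _ _ F).
(* the antiderivative takes equal values at the endpoints, being 2 pi-periodic *)
- have e : expi (pi * m%:~R : R) = expi (- pi * m%:~R).
    rewrite -[RHS]mulr1 -[X in _ = _ * X](expi2pi_int m) -expiD -mulrDl.
    by congr (expi (_ * _)); rewrite mulr2n; ring.
  by case: e => ec es; rewrite /F ec es subee.
- by rewrite gtrN ?pi_gt0.
- by apply: continuous_subspaceT => x; exact: continuous_trig.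
- split; first by move=> x _; have [] := is_derive_trig (- (b / m%:~R)) (a / m%:~R) m%:~R x.
  + by apply: cvg_at_right_filter; exact: continuous_trig.
  + by apply: cvg_at_left_filter; exact: continuous_trig.
- move=> x _; rewrite derive1E /F.
  have d := is_derive_trig (- (b / m%:~R)) (a / m%:~R) m%:~R x.
  by rewrite derive_val; field.
Qed.

Lemma torus_integral_expi (c : R[i]) m :
  torus_integral (fun y : R => c * expi (y * m%:~R)) =
  if m == 0 then (pi *+ 2)%:C * c else 0.
Proof.
case: c => a b; rewrite /torus_integral /=.
under eq_Rintegral do rewrite -mulNr.
rewrite Rintegral_trig.
under eq_Rintegral do rewrite addrC.
by rewrite Rintegral_trig; case: ifP => // _; congr (_ +i* _); rewrite /= ?mul0r ?subr0 ?addr0.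
Qed.

(** The k-th integral is a multiple of the integral of [exp (i (m - k) y)], so only
    [k = m] contributes to the sum. *)
Lemma pdo_expi (sigma : R -> int -> R[i]) m x :
  pdo sigma (fun y => expi (y * m%:~R)) x = sigma x m * expi (x * m%:~R).
Proof.
rewrite /pdo.
pose b := (pi *+ 2)%:C * (sigma x m * expi (x * m%:~R)) : R[i].
have ak k : torus_integral (fun y => expi ((x - y) * k%:~R) * sigma x k * expi (y * m%:~R)) =
    if k == m then b else 0.
  rewrite (_ : (fun y => _) = (fun y => (sigma x k * expi (x * k%:~R)) * expi (y * (m - k)%:~R))).
    by rewrite torus_integral_expi subr_eq0 eq_sym; case: eqVneq => [->|].
  apply/funext => y; rewrite (mulrC (expi _)) -!mulrA -!expiD.
  by congr (_ * expi _); rewrite rmorphB /=; ring.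
under [X in sum_int X]eq_fun do rewrite ak.
(* the symmetric partial sums are constant as soon as [|m| <= N] *)
rewrite (_ : sum_int _ = b).
  by rewrite /b mulrA -rmorphM mulVf ?mul1r// mulrn_eq0/= gt_eqF// pi_gt0.
have e : \forall N \near \oo,
    \sum_(0 <= j < N.*2.+1) (if j%:Z - N%:Z == m then b else 0) = b.
  near=> N.
  have mN : (`|m| <= N)%N by near: N; exists `|m|%N.
  rewrite (bigD1_seq (absz (m + N%:Z))) ?iota_uniq//=.
    rewrite (_ : _ == m) ?big1 ?addr0 //.
    - by move=> j jm; rewrite ifF//; apply/eqP => jNm; move/eqP: jm; apply; lia.
    - lia.
  by rewrite mem_index_iota; lia.
rewrite /sum_int; case: b {ak} e => br bi e; congr (_ +i* _); apply: lim_near_cst => //;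
  by apply: filterS e => N ->.
Unshelve. all: by end_near. Qed.

End trig.

(** * Regularity of symbols *)

Section symbol.
Variable R : realType.
Implicit Types (x y t : R) (k : int) (sigma : R -> int -> R[i]).

Lemma normc_ge_Re (z : R[i]) : `|complex.Re z| <= normc z.
Proof.
case: z => a b /=; rewrite -sqrtr_sqr ler_wsqrtr//.
by rewrite lerDl sqr_ge0.
Qed.

Lemma normc_ge_Im (z : R[i]) : `|complex.Im z| <= normc z.
Proof.
case: z => a b /=; rewrite -sqrtr_sqr ler_wsqrtr//.
by rewrite lerDr sqr_ge0.
Qed.

Lemma normc_le_ReIm (z : R[i]) : normc z <= `|complex.Re z| + `|complex.Im z|.
Proof.
case: z => a b /=; rewrite -[leRHS]ger0_norm ?addr_ge0// -sqrtr_sqr ler_wsqrtr//.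
by rewrite sqrrD !real_normK ?num_real// lerD2r lerDl mulrn_wge0// mulr_ge0.
Qed.

Lemma lipschitz_of_derive1 (f : R -> R) C : (forall x, derivable f x 1) ->
  (forall x, `|derive1 f x| <= C) -> forall x y, `|f x - f y| <= C * `|x - y|.
Proof.
move=> df fC.
have lt x y : x < y -> `|f x - f y| <= C * `|x - y|.
  move=> xy; have [||c _ e] := @MVT R f (derive1 f) x y xy.
  - by move=> z _; rewrite derive1E; exact: derivableP.
  - apply: continuous_subspaceT => z.
    exact/differentiable_continuous/derivable1_diffP.
  by rewrite distrC e normrM (distrC x) ler_wpM2r.
move=> x y; case: (ltgtP x y) => [/lt//|/lt|->].
  by rewrite distrC (distrC y).
by rewrite !subrr normr0 mulr0.
Qed.

Lemma symbol_M_S Lam rho m sigma : symbol_M Lam rho m sigma -> symbol_S Lam rho m sigma.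
Proof.
move=> [_ /(_ 0 isT)]; rewrite (_ : (fun x k => _) = sigma)//.
by apply/funext => x; apply/funext => k; rewrite expr0 mul1r.
Qed.

(** In order [0] the weight disappears from the estimate on the first derivative in
    [x], so the Lipschitz constant does not depend on [k]. *)
Lemma symbol_lipschitz Lam rho sigma : symbol_S Lam rho 0 sigma ->
  exists2 C, 0 < C & forall x y k, normc (sigma x k - sigma y k) <= C * `|x - y|.
Proof.
move=> [sm /(_ 0 1)[C C0 hC]]; exists (C *+ 2); first by rewrite pmulrn_lgt0.
move=> x y k; have [_ sk] := sm k.
have bd z : normc (cderive1n 1 (sigma^~ k) z) <= C.
  by have := hC z k; rewrite /= mulr0 subr0 powRr0 mulr1.
have lRe := @lipschitz_of_derive1 (fun z => complex.Re (sigma z k)) C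
  (fun z => (sk 0 z).1) (fun z => le_trans (normc_ge_Re _) (bd z)) x y.
have lIm := @lipschitz_of_derive1 (fun z => complex.Im (sigma z k)) C
  (fun z => (sk 0 z).2) (fun z => le_trans (normc_ge_Im _) (bd z)) x y.
apply: le_trans (normc_le_ReIm _) _; rewrite mulr2n mulrDl.
by apply: lerD; [move: lRe|move: lIm]; case: (sigma x k) (sigma y k) => ? ? [].
Qed.

(** A weak form of Jordan's inequality.  On the first half of the interval the mean
    value theorem and [cos ^ 2 >= 1/2] suffice; doubling the angle gives the
    rest, as [sin t = 2 sin (t/2) cos (t/2) >= t (1/2)]. *)
Lemma ge_half_sin t : 0 <= t <= pi / 2 -> t / 2 <= sin t.
Proof.
case/andP; rewrite le_eqVlt => /predU1P[<- _|t0 tpi]; first by rewrite mul0r sin0.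
have pi0 := pi_gt0 R.
have u0 : 0 < t / 2 by rewrite divr_gt0.
have cos_ge y : 0 <= y <= t / 2 -> 0 <= cos y /\ 1 / 2 <= cos y ^+ 2.
  case/andP => y0 yt; split; first by apply: cos_ge0_pihalf; apply/andP; split; lra.
  have : 0 <= cos (y *+ 2).
    by apply: cos_ge0_pihalf; rewrite (mulr2n y); apply/andP; split; lra.
  by rewrite cos_mulr2n; lra.
have [|c] := @MVT R sin cos 0 (t / 2) u0 (fun x _ => is_derive_sin x).
  by apply: continuous_subspaceT; exact: continuous_sin.
rewrite in_itv/= => /andP[/ltW c0 /ltW cu]; rewrite sin0 !subr0 => e.
have [c1 c2] := cos_ge c (introT andP (conj c0 cu)).
have [d1 d2] := cos_ge (t / 2) (introT andP (conj (ltW u0) (lexx _))).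
have -> : sin t = sin (t / 2 *+ 2) by congr sin; rewrite (mulr2n (t / 2)); lra.
rewrite sin_mulr2n e.
suff : 1 / 2 <= cos (t / 2) * cos c by nra.
rewrite -(@ler_pXn2r _ 2)// ?nnegrE; [|lra|exact: mulr_ge0].
by rewrite exprMn; nra.
Qed.

Lemma normr_le_chord t : `|t| <= pi -> `|t| <= 2 * normc (1 - expi t).
Proof.
move=> tpi.
have -> : normc (1 - expi t) = `|2 * sin (t / 2)|.
  rewrite -sqrtr_sqr; congr Num.sqrt; rewrite /= exprMn.
  have -> : t = t / 2 *+ 2 by rewrite (mulr2n (t / 2)); lra.
  rewrite sin_mulr2n cos_mulr2n (_ : t / 2 *+ 2 / 2 = t / 2); last by rewrite (mulr2n (t / 2)); lra.
  have h : cos (t / 2) ^+ 2 = 1 - sin (t / 2) ^+ 2 := cos2sin2 _.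
  transitivity ((2 - 2 * cos (t / 2) ^+ 2) ^+ 2 + 4 * cos (t / 2) ^+ 2 * sin (t / 2) ^+ 2).
    by ring.
  by rewrite h; ring.
have e : `|sin (t / 2)| = sin (`|t| / 2).
  have h : 0 <= sin (`|t| / 2).
    by apply: le_trans (ge_half_sin _); rewrite ?divr_ge0//=; have := normr_ge0 t; lra.
  move: h; case: (ger0P t) => _ h; first by rewrite ger0_norm.
  by move: h; rewrite mulNr sinN oppr_ge0 => h; rewrite ler0_norm.
rewrite normrM e.
rewrite (ger0_norm (_ : 0 <= 2)) //.
have : `|t| / 2 / 2 <= sin (`|t| / 2).
  by apply: ge_half_sin; have := normr_ge0 t; lra.
by lra.
Qed.

(** By periodicity the distance can be measured on the circle, where it is
    comparable to the chord [|1 - exp (i (x - y))|]; the chord is the factor that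
    makes the Dirichlet kernel telescope. *)
Lemma symbol_chord Lam rho sigma : symbol_S Lam rho 0 sigma ->
  exists2 C, 0 < C & forall x y k, x \in `[- pi, pi] -> y \in `[- pi, pi] ->
    normc (sigma x k - sigma y k) <= C * normc (1 - expi (x - y)).
Proof.
move=> hS; have [C C0 hC] := symbol_lipschitz hS; have [sm _] := hS.
exists (C * 2); first by rewrite mulr_gt0.
move=> x y k; rewrite !in_itv => /andP[x1 x2] /andP[y1 y2].
rewrite /= in x1 x2 y1 y2.
(* distances on the circle are attained by translating [y] by a period *)
have [y' [s1 s2 s3]] : exists y', [/\ sigma y' k = sigma y k,
    expi (x - y') = expi (x - y) & `|x - y'| <= pi].
  have [per _] := sm k.
  have [h|h] := ltP pi (x - y).
    exists (y + pi *+ 2); split; first exact: per.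
      rewrite opprD addrA (expiD (x - y)) -[RHS]mulr1; congr (_ * _).
      by have := expi2pi_int R (- 1); rewrite mulrN mulr1.
    by rewrite ler_norml (mulr2n pi); lra.
  have [h'|h'] := ltP (x - y) (- pi).
    exists (y - pi *+ 2); split; first by rewrite -(per (y - pi *+ 2)) subrK.
      rewrite opprB addrCA addrC (expiD (x - y)) -[RHS]mulr1; congr (_ * _).
      by have := expi2pi_int R 1; rewrite mulr1.
    by rewrite ler_norml (mulr2n pi); lra.
  by exists y; split => //; rewrite ler_norml h' h.
rewrite -s1 -s2; apply: le_trans (hC x y' k) _.
by rewrite -mulrA ler_pM2l// normr_le_chord.
Qed.

Lemma weight_unbounded (Lam : int -> R) mu M : weight_function Lam mu ->
  exists N : nat, forall k, (N <= `|k|)%N -> M <= Lam k.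
Proof.
move=> [_ [mu0 [mu1 [C0 [C1 [/andP[mu00 _] _ C00 _ h]]]]] _].
have [M0|M0] := leP M 0.
  exists 0%N => k _; have /andP[h1 _] := h k; apply: le_trans M0 (le_trans _ h1).
  by rewrite mulr_ge0 ?powR_ge0// ltW.
pose B := (M / C0) `^ mu0^-1; have [N hN] : exists N : nat, B <= N%:R.
  by exists (Num.truncn B).+1; rewrite ltW// truncnS_gt.
exists N => k Nk; have /andP[h1 _] := h k; apply: le_trans h1.
rewrite -ler_pdivrMl// mulrC.
have -> : M / C0 = B `^ mu0.
  by rewrite -powRrM mulVf ?gt_eqF// powRr1// divr_ge0 ?ltW.
apply: ge0_ler_powR; rewrite ?nnegrE ?powR_ge0 ?addr_ge0 ?ler0z ?(ltW mu00)//.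
apply: le_trans hN _; rewrite -natr_absz.
by apply: le_trans (_ : `|k|%N%:R <= _); rewrite ?ler_nat// lerDr.
Qed.

(** One difference in [k] gains the factor [Lam k ^ (- rho)], which tends to [0]
    since [Lam] grows at least like a positive power. *)
Lemma symbol_slow (Lam : int -> R) (mu rho : R) sigma (eta : R) : weight_function Lam mu -> 0 < rho ->
  symbol_S Lam rho 0 sigma -> 0 < eta ->
  exists N : nat, forall k x, (N <= `|k|)%N ->
    normc (sigma x (k + 1) - sigma x k) <= eta.
Proof.
move=> hL rho0 [_ /(_ 1 0)[C C0 hC]] eta0.
have [N hN] := weight_unbounded ((C / eta) `^ rho^-1) hL.
exists N => k x Nk.
have -> : sigma x (k + 1) - sigma x k =
    iter 1 (@Delta R[i]) (fun l => cderive1n 0 (sigma^~ l) x) k.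
  by rewrite /= /Delta /cderive1n /=; case: (sigma x (k + 1)) (sigma x k) => ? ? [].
apply: le_trans (hC x k) _; rewrite mulr1 sub0r powRN.
have L0 : 0 < Lam k by case: hL.
rewrite ler_pdivrMr ?powR_gt0//.
rewrite mulrC -ler_pdivrMr//.
have -> : C / eta = ((C / eta) `^ rho^-1) `^ rho.
  by rewrite -powRrM mulVf ?gt_eqF// powRr1// divr_ge0 ?ltW.
by apply: ge0_ler_powR (hN k Nk); rewrite ?nnegrE ?powR_ge0// ltW.
Qed.

Lemma symbol_slow_iter sigma (eta : R) N : 
  (forall k x, (N <= `|k|)%N -> normc (sigma x (k + 1) - sigma x k) <= eta) ->
  forall k x j, (N + j <= `|k|)%N -> normc (sigma x (k + j%:Z) - sigma x k) <= j%:R * eta.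
Proof.
move=> h k x; elim=> [|j IH] kj; first by rewrite addr0 subrr normc0 mul0r.
have -> : sigma x (k + j.+1%:Z) - sigma x k =
    (sigma x (k + j%:Z) - sigma x k) + (sigma x (k + j%:Z + 1) - sigma x (k + j%:Z)).
  by rewrite [RHS]addrC addrA subrK -addrA -PoszD addn1.
apply: le_trans (le_normcD _ _) _; rewrite mulrSr mulrDl mul1r; apply: lerD.
  by apply: IH; lia.
by apply: h; lia.
Qed.

End symbol.

(** * Norms of trigonometric polynomials *)

Section L2.
Variable R : realType.
Local Notation mu := (torus_measure R).
Implicit Types (u v w : L2torus R) (f g : measurableTypeR R -> R[i]) (m : int).

(** Elements of [L2torus R] are evaluated through a chosen representative, which is
    additive and homogeneous only up to a null set. *)
Lemma L2torusD_ae u v : (u + v : L2torus R) = (fun x => u x + v x) %[ae mu].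
Proof.
have e : \pi_(L2torus R) (repr u + repr v) = u + v by rewrite raddfD /= !reprK.
by apply: filterS (L2torus_pi (repr u + repr v)) => x + _ => /(_ I); rewrite e.
Qed.

Lemma L2torusZ_ae (a : R[i]) u : (a *: u : L2torus R) = (fun x => a * u x) %[ae mu].
Proof.
have e : \pi_(L2torus R) (a *: repr u) = a *: u by rewrite pi_scale reprK.
by apply: filterS (L2torus_pi (a *: repr u)) => x + _ => /(_ I); rewrite e.
Qed.

Lemma L2torus0_ae : (0 : L2torus R) = (fun=> 0) %[ae mu].
Proof.
have e : \pi_(L2torus R) 0 = 0 by rewrite raddf0.
by apply: filterS (L2torus_pi (0 : L2pre R)) => x + _ => /(_ I); rewrite e.
Qed.

Lemma L2torus_lincomb_ae (I : Type) (s : seq I) (a : I -> R[i]) (e : I -> L2torus R)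
    (h : I -> measurableTypeR R -> R[i]) : (forall i, e i = h i %[ae mu]) ->
  (\sum_(i <- s) a i *: e i : L2torus R) = (fun x => \sum_(i <- s) a i * h i x) %[ae mu].
Proof.
move=> eh; elim: s => [|i s IH].
  by rewrite big_nil; apply: filterS L2torus0_ae => x + _ => /(_ Logic.I) ->; rewrite big_nil.
rewrite big_cons.
have h1 := L2torusD_ae (a i *: e i) (\sum_(j <- s) a j *: e j).
have h2 := L2torusZ_ae (a i) (e i).
apply: filterS2 (filterI h1 h2) (filterI IH (eh i)) => x [e1 e2] [e3 e4] _.
by rewrite e1// e2// e3// e4// big_cons.
Qed.

Lemma L2torus_measurable u :
  measurable_fun setT (fun x => complex.Re (u x)) /\ measurable_fun setT (fun x => complex.Im (u x)).
Proof. by have /asboolP[] : (u : _ -> _) \in @L2fun R := valP (repr u). Qed.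

Lemma L2norm_ge0 u : 0 <= L2norm u.
Proof. by rewrite -lee_fin L2normE Lnorm_ge0. Qed.

Lemma measurable_normc_sqr f :
  measurable_fun setT (fun x => complex.Re (f x)) ->
  measurable_fun setT (fun x => complex.Im (f x)) ->
  measurable_fun setT (fun x => normc (f x) ^+ 2).
Proof. by move=> mr mi; apply: measurable_funX; exact: L2fun_measurable_normc0. Qed.

Lemma L2norm_fun_integral f :
  L2norm_fun f = ((\int[mu]_x (normc (f x) ^+ 2)%:E) `^ 2^-1)%E.
Proof.
rewrite /L2norm_fun unlock; congr poweR; apply: eq_integral => x _ /=.
by rewrite ger0_norm ?normc_ge0// powR_mulrn ?normc_ge0.
Qed.

Lemma L2norm_sqr_integral u f :
  measurable_fun setT (fun x => complex.Re (f x)) ->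
  measurable_fun setT (fun x => complex.Im (f x)) ->
  u = f %[ae mu] -> ((L2norm u ^+ 2)%:E = \int[mu]_x (normc (f x) ^+ 2)%:E)%E.
Proof.
move=> mr mi uf; have [mr' mi'] := L2torus_measurable u.
rewrite (_ : integral _ _ _ = \int[mu]_x (normc (u x) ^+ 2)%:E)%E; last first.
  apply: ge0_ae_eq_integral => //.
  - by apply/measurable_EFinP; exact: measurable_normc_sqr.
  - by apply/measurable_EFinP; exact: measurable_normc_sqr.
  - by move=> x _; rewrite lee_fin sqr_ge0.
  - by move=> x _; rewrite lee_fin sqr_ge0.
  - by apply: filterS uf => x + _ => /(_ I) ->.
have I0 : (0 <= \int[mu]_x (normc (u x) ^+ 2)%:E)%E.
  by apply: integral_ge0 => x _; rewrite lee_fin sqr_ge0.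
rewrite -powR_mulrn ?L2norm_ge0// -poweR_EFin L2normE L2norm_fun_integral -poweRrM mulVf//.
by rewrite poweRe1.
Qed.

Lemma L2norm_sqr u f :
  measurable_fun setT (fun x => complex.Re (f x)) ->
  measurable_fun setT (fun x => complex.Im (f x)) ->
  u = f %[ae mu] -> L2norm u ^+ 2 = \int[mu]_x (normc (f x) ^+ 2).
Proof. by move=> mr mi uf; rewrite /Rintegral -(L2norm_sqr_integral mr mi uf). Qed.

Lemma L2norm_le_sup u M : 0 <= M -> {ae mu, forall x, normc (u x) <= M} ->
  L2norm u <= M * Num.sqrt (pi *+ 2).
Proof.
move=> M0 uM; have [mr mi] := L2torus_measurable u.
rewrite -(@ler_pXn2r _ 2)// ?nnegrE ?L2norm_ge0 ?mulr_ge0 ?sqrtr_ge0//.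
rewrite exprMn sqr_sqrtr; last by rewrite mulrn_wge0// pi_ge0.
rewrite -lee_fin (L2norm_sqr_integral mr mi); last exact: aeW.
apply: (@le_trans _ _ (\int[mu]_x (M ^+ 2)%:E)%E); last first.
  by rewrite integral_cst// torus_measureT -EFinM.
apply: ae_ge0_le_integral => //.
- by move=> x _; rewrite lee_fin sqr_ge0.
- by apply/measurable_EFinP; exact: measurable_normc_sqr.
- by move=> x _; rewrite lee_fin sqr_ge0.
- by apply: filterS uM => x uM _; rewrite lee_fin ler_pXn2r// nnegrE normc_ge0.
Qed.

Definition expi_fun m : measurableTypeR R -> R[i] := fun x => expi (x * m%:~R).

Lemma measurable_Re_expi m : measurable_fun setT (fun x => complex.Re (expi_fun m x)).
Proof.
rewrite (_ : (fun x => _) = (fun x => 1 * cos (x * m%:~R) + 0 * sin (x * m%:~R))).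
  exact: measurable_trig.
by apply/funext => x /=; rewrite mul1r mul0r addr0.
Qed.

Lemma measurable_Im_expi m : measurable_fun setT (fun x => complex.Im (expi_fun m x)).
Proof.
rewrite (_ : (fun x => _) = (fun x => 0 * cos (x * m%:~R) + 1 * sin (x * m%:~R))).
  exact: measurable_trig.
by apply/funext => x /=; rewrite mul1r mul0r add0r.
Qed.

Lemma expi_fun_L2 m : expi_fun m \in @L2fun R.
Proof.
apply/asboolP; split; [exact: measurable_Re_expi|exact: measurable_Im_expi|].
rewrite L2norm_fun_integral.
under eq_integral do rewrite normc_expi expr1n.
by rewrite integral_cst// mul1e torus_measureT poweR_EFin ltry.
Qed.

Definition expi_L2 m : L2torus R := \pi_(L2torus R) (MkL2pre (expi_fun_L2 m)).

Lemma expi_L2_ae m : expi_L2 m = expi_fun m %[ae mu].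
Proof. exact: L2torus_pi. Qed.

Lemma Rintegral_sum (I : Type) (s : seq I) (h : I -> measurableTypeR R -> R) :
  (forall i, mu.-integrable setT (EFin \o h i)) ->
  \int[mu]_x (\sum_(i <- s) h i x) = \sum_(i <- s) \int[mu]_x h i x.
Proof.
move=> ih; rewrite /Rintegral.
under eq_integral do rewrite -sumEFin.
rewrite integral_sum// sum_fine// => i _.
exact: integrable_fin_num (ih i).
Qed.

Lemma normc_sum_sqr (I : finType) (z : I -> R[i]) :
  normc (\sum_i z i) ^+ 2 = \sum_(p : I * I) complex.Re (z p.1 * (z p.2)^*).
Proof.
have sq (x : R[i]) : normc x ^+ 2 = complex.Re (x * x^*).
  by case: x => a b /=; rewrite sqr_sqrtr ?addr_ge0 ?sqr_ge0// mulrN opprK -!expr2.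
rewrite sq rmorph_sum mulr_suml.
under eq_bigr do rewrite mulr_sumr.
by rewrite pair_bigA /= raddf_sum.
Qed.

(** Parseval's identity for finite sums: expanding the squared modulus leaves the
    integrals of [exp (i (m j - m k) x)], which vanish off the diagonal. *)
Lemma L2norm_lincomb (I : finType) (a : I -> R[i]) (m : I -> int) : injective m ->
  L2norm (\sum_i a i *: expi_L2 (m i)) ^+ 2 = pi *+ 2 * \sum_i normc (a i) ^+ 2.
Proof.
move=> minj.
have h := L2torus_lincomb_ae (index_enum I) a (fun i => expi_L2_ae (m i)).
rewrite (L2norm_sqr _ _ h); last 2 first.
- rewrite (_ : (fun x => _) = (fun x => \sum_i complex.Re (a i * expi_fun (m i) x))).
    apply: measurable_sum => i.
    under eq_fun do rewrite Defs.ReM.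
    by apply: measurable_funB; apply: measurable_funM => //;
      [exact: measurable_Re_expi|exact: measurable_Im_expi].
  by apply/funext => x; rewrite raddf_sum.
- rewrite (_ : (fun x => _) = (fun x => \sum_i complex.Im (a i * expi_fun (m i) x))).
    apply: measurable_sum => i.
    under eq_fun do rewrite Defs.ImM.
    by apply: measurable_funD; apply: measurable_funM => //;
      [exact: measurable_Im_expi|exact: measurable_Re_expi].
  by apply/funext => x; rewrite raddf_sum.
under eq_Rintegral do rewrite normc_sum_sqr.
pose c (p : I * I) := a p.1 * (a p.2)^*.
pose H (p : I * I) x := complex.Re (c p) * cos (x * (m p.1 - m p.2)%:~R) +
   - complex.Im (c p) * sin (x * (m p.1 - m p.2)%:~R).
rewrite (_ : (fun x => _) = (fun x => \sum_p H p x)); last first.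
  apply/funext => x; apply: eq_bigr => -[i j] _ /=.
  rewrite rmorphM mulrACA (_ : expi_fun _ _ * _ = expi (x * (m i - m j)%:~R)).
    by rewrite Defs.ReM /H /c mulNr.
  have conj_expi (t : R) : expi (- t) = (expi t)^* by rewrite /expi cosN sinN.
  by rewrite rmorphB mulrBr expiD conj_expi.
rewrite Rintegral_sum; last by move=> p; exact: integrable_trig.
rewrite -(pair_bigA _ (fun i j => \int[mu]_x H (i, j) x)) /= mulr_sumr.
apply: eq_bigr => i _; rewrite (bigD1 i)//= big1 ?addr0; last first.
  by move=> j ji; rewrite Rintegral_trig subr_eq0 (inj_eq minj) eq_sym (negbTE ji).
rewrite Rintegral_trig subrr eqxx; congr (_ * _); rewrite /c /=.
by case: (a i) => p q /=; rewrite sqr_sqrtr ?addr_ge0 ?sqr_ge0// mulrN opprK -!expr2.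
Qed.

End L2.

(** * Compact operators and oscillating exponentials *)

Section compactness.
Variable R : realType.
Implicit Types (u v w p : L2torus R) (K : L2torus R -> L2torus R).

Lemma normcR (r : R) : normc r%:C = `|r|.
Proof. by rewrite /= expr0n addr0 sqrtr_sqr. Qed.

Lemma L2normN u : L2norm (- u) = L2norm u.
Proof. by rewrite -scaleN1r L2normZ normcN normc1 mul1r. Qed.

Lemma L2normB u v : L2norm (u - v) = L2norm (v - u).
Proof. by rewrite -opprB L2normN. Qed.

Lemma L2norm_sum (I : Type) (s : seq I) (f : I -> L2torus R) :
  L2norm (\sum_(i <- s) f i) <= \sum_(i <- s) L2norm (f i).
Proof.
elim: s => [|i s IH].
  by rewrite !big_nil -(scale0r 0) L2normZ normc0 mul0r.
by rewrite !big_cons; apply: le_trans (L2normD _ _) _; rewrite lerD2l.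
Qed.

(** The sequential content of compactness that is used below: images of a bounded
    sequence accumulate somewhere. *)
Lemma compact_operator_cluster K (u : nat -> L2torus R) M : compact_operator K ->
  (forall n, L2norm (u n) <= M) ->
  exists p, forall e n0, 0 < e -> exists2 n, (n0 <= n)%N & L2norm (K (u n) - p) < e.
Proof.
move=> hK uM.
have M0 : 0 <= M := le_trans (L2norm_ge0 _) (uM 0).
have bu : bounded_set (range u).
  exists M%:C; split; first by apply: ger0_real; rewrite lecR.
  move=> y My _ [n _ <-] /=; rewrite L2_normE; apply: le_trans (ltW My).
  by rewrite lecR.
have := hK _ bu; rewrite precompactE => /(_ ((K \o u) @ \oo) _)[].
  apply: filterS (subset_closure (A := K @` range u)) _.
  by exists 0%N => // n _; exists (u n) => //; exists n.
move=> p [_ pc]; exists p => e n0 e0.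
have e0C : 0 < e%:C by rewrite ltcR.
have un0 : ((K \o u) @ \oo) [set K (u n) | n in [set n | (n0 <= n)%N]].
  by exists n0 => // n n0n; exists n.
have [_ [[n n0n <-]]] := pc _ _ un0 (nbhsx_ballx p _ e0C).
by rewrite -ball_normE /ball_ /= L2_normE ltcR L2normB; exists n.
Qed.

(** The exponentials tend weakly to [0], so their images under a compact operator
    tend to [0] in norm.  Weak convergence enters only through Parseval's
    identity: if infinitely many [K e_m] were close to one vector [p] bounded away
    from [0], then [n] of them would add up to a vector of norm of order [n],
    whereas the sum of the [e_m] has norm of order [sqrt n]. *)
Lemma compact_operator_expi (K : {linear L2torus R -> L2torus R}) e :
  compact_operator K -> 0 < e ->
  exists N : nat, forall m : int, (N <= `|m|)%N -> L2norm (K (expi_L2 R m)) < e.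
Proof.
move=> hK e0; apply: contrapT => /forallNP notN.
have {notN} bad N : exists m : int, (N <= `|m|)%N /\ e <= L2norm (K (expi_L2 R m)).
  have /existsNP[m /not_implyP[Nm /negP]] := notN N.
  by rewrite -leNgt => h; exists m.
have [m_ hm] := choice bad.
have nE m : L2norm (expi_L2 R m) <= Num.sqrt (pi *+ 2).
  rewrite -[leRHS]mul1r; apply: L2norm_le_sup => //.
  by apply: filterS (expi_L2_ae R m) => x -> //; rewrite normc_expi.
have [p hp] := compact_operator_cluster (u := fun n => expi_L2 R (m_ n)) hK (fun n => nE _).
have e4 : 0 < e / 4 by rewrite divr_gt0.
have near n0 : exists m : int, (n0 <= `|m|)%N /\ L2norm (K (expi_L2 R m) - p) < e / 4.
  have [n n0n h] := hp _ n0 e4; exists (m_ n); split => //.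
  by apply: leq_trans (hm n).1.
have [g hg] := choice near.
have pe : e - e / 4 <= L2norm p.
  have [n _ h] := hp _ 0%N e4; have [_ h'] := hm n.
  have := L2normD (K (expi_L2 R (m_ n)) - p) p; rewrite subrK.
  by move: h h' => /=; lra.
(* frequencies of strictly increasing absolute value, hence distinct, with images close to [p] *)
pose k_ j := iter j (fun m : int => g `|m|.+1%N) (g 0).
have k_lt i j : (i < j)%N -> (`|k_ i| < `|k_ j|)%N.
  elim: j => // j IH; rewrite ltnS leq_eqVlt => /predU1P[->|/IH h].
    exact: (hg _).1.
  exact: ltn_trans h (hg _).1.
have k_near j : L2norm (K (expi_L2 R (k_ j)) - p) < e / 4.
  by case: j => [|j]; exact: (hg _).2.
pose v N := \sum_(j < N) 1 *: expi_L2 R (k_ j).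
have vE N : L2norm (v N) ^+ 2 = pi *+ 2 * N%:R.
  rewrite /v (@L2norm_lincomb _ _ _ (fun j : 'I_N => k_ j)).
    by under eq_bigr do rewrite normc1 expr1n; rewrite sumr_const card_ord.
  move=> i j ij; apply/val_inj; case: (ltngtP i j) => // /k_lt; rewrite ij ltnn//.
have Kv N : N%:R * (e / 2) <= L2norm (K (v N)).
  have -> : K (v N) = (\sum_(j < N) (K (expi_L2 R (k_ j)) - p)) + N%:R *: p.
    rewrite sumrB sumr_const card_ord scaler_nat subrK linear_sum.
    by apply: eq_bigr => j _; rewrite scale1r.
  set w := \sum_(j < N) _.
  have w4 : L2norm w <= N%:R * (e / 4).
    apply: le_trans (L2norm_sum _ _) _.
    apply: le_trans (_ : \sum_(j < N) e / 4 <= _).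
      by apply: ler_sum => j _; exact: ltW.
    by rewrite sumr_const card_ord mulr_natl.
  have := L2normD (w + N%:R *: p) (- w); rewrite addrAC subrr add0r.
  rewrite L2normZ L2normN.
  have -> : normc (N%:R : R[i]) = N%:R.
    by rewrite -(@rmorph_nat _ _ (real_complex R)) normcR normr_nat.
  have : N%:R * (e - e / 4) <= N%:R * L2norm p by rewrite ler_wpM2l.
  have : 0 <= N%:R :> R by [].
  by rewrite mulrBr; lra.
(* [n.+1 ^ 2] terms divided by [n.+1]: bounded vectors with unbounded images, which cannot cluster *)
have normVn n : normc (n.+1%:R^-1)%:C = n.+1%:R^-1 :> R.
  by rewrite normcR ger0_norm// invr_ge0.
pose u n := (n.+1%:R^-1)%:C *: v (n.+1 ^ 2)%N.
have un n : L2norm (u n) <= Num.sqrt (pi *+ 2).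
  rewrite -(@ler_pXn2r _ 2)// ?nnegrE ?L2norm_ge0 ?sqrtr_ge0//.
  rewrite sqr_sqrtr; last by rewrite mulrn_wge0// pi_ge0.
  by rewrite /u L2normZ normVn exprMn vE natrX exprVn mulrCA mulVf ?mulr1.
have [q hq] := compact_operator_cluster hK un.
have [n0 hn0] : exists n : nat, (L2norm q + 1) / (e / 2) < n%:R.
  by exists (Num.truncn ((L2norm q + 1) / (e / 2))).+1; rewrite truncnS_gt.
have [n n0n Ku] := hq 1 n0 ltr01.
have : n.+1%:R * (e / 2) <= L2norm (K (u n)).
  rewrite /u linearZ L2normZ normVn ler_pdivlMl//.
  by apply: le_trans (Kv _); rewrite natrX expr2 -mulrA.
have : L2norm (K (u n)) <= L2norm (K (u n) - q) + L2norm q.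
  by have := L2normD (K (u n) - q) q; rewrite subrK.
have : (L2norm q + 1) < n.+1%:R * (e / 2).
  rewrite -ltr_pdivrMr ?divr_gt0//; apply: lt_le_trans hn0 _.
  by rewrite ler_nat leqW.
by lra.
Qed.

End compactness.

(** * Approximate eigenvectors of the operator *)

Section eigenvector.
Variable R : realType.
Implicit Types (sigma : R -> int -> R[i]) (x : R) (k : int).
Local Notation mu := (torus_measure R).

Lemma pdo_expi_L2 sigma (T : L2torus R -> L2torus R) m : extends_pdo sigma T ->
  T (expi_L2 R m) = (fun x => sigma x m * expi_fun m x) %[ae mu].
Proof.
move=> hT; have := hT _ _ (torus_smooth_expi R m) (expi_L2_ae R m).
by apply: filterS => x + _ => /(_ I) ->; rewrite pdo_expi.
Qed.

Lemma ae_torus (P : measurableTypeR R -> Prop) :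
  (forall x, x \in `[- pi, pi] -> P x) -> {ae mu, forall x, P x}.
Proof.
move=> h; exists (~` `[- pi, pi]); split.
- by apply: measurableC; exact: measurable_itv.
- by rewrite /torus_measure/= /mrestr setICl measure0.
- by move=> x /= Px xI; apply: Px; exact: h.
Qed.

Lemma normc_sum_le (I : Type) (s : seq I) (z : I -> R[i]) :
  normc (\sum_(i <- s) z i) <= \sum_(i <- s) normc (z i).
Proof.
elim: s => [|i s IH]; first by rewrite !big_nil normc0.
by rewrite !big_cons; apply: le_trans (le_normcD _ _) _; rewrite lerD2l.
Qed.

(** Multiplied by [1 - exp (i t)], the geometric sum telescopes to [1 - exp (i N t)]. *)
Lemma dirichlet_chord (t : R) N :
  normc (1 - expi t) * normc (\sum_(j < N) expi t ^+ j) <= 2.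
Proof.
rewrite -normcM -[X in X - _](expr1n _ N) -opprB.
have -> : - (expi t - 1 ^+ N) * \sum_(j < N) expi t ^+ j = 1 - expi t ^+ N.
  by rewrite expr1n mulNr -subrX1 opprB.
apply: le_trans (le_normcD _ _) _.
by rewrite normcN normc1 -expiMn normc_expi.
Qed.

(** The pointwise form of the approximate eigenvalue equation.  With
    [z = exp (i (x - x0))] the sum is [e_k] times
    [(sigma x k - sigma x0 k) * sum z ^ j + sum z ^ j (sigma x (k + j) - sigma x k)]:
    the first part is controlled by the chord estimate, the second one by the slow
    variation in [k]. *)
Lemma dirichlet_symbol_error sigma L eta N k x x0 : 0 <= L -> 0 <= eta ->
  normc (sigma x k - sigma x0 k) <= L * normc (1 - expi (x - x0)) ->
  (forall j, (j < N)%N -> normc (sigma x (k + j%:Z) - sigma x k) <= j%:R * eta) ->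
  normc (\sum_(j < N) expi (- x0) ^+ j *
     ((sigma x (k + j%:Z) - sigma x0 k) * expi_fun (k + j%:Z) x)) <=
  2 * L + N%:R ^+ 2 * eta.
Proof.
move=> L0 eta0 hL hN.
have e (j : nat) : expi (- x0) ^+ j * expi_fun (k + j%:Z) x =
    expi (x * k%:~R) * expi (x - x0) ^+ j.
  rewrite /expi_fun -!expiMn -!expiD; congr expi.
  by rewrite rmorphD /= -[j%:~R]/(j%:R) mulrDr mulr_natr mulrnBl mulNrn; ring.
under eq_bigr => j _.
  rewrite mulrCA e (_ : _ - _ = (sigma x (k + j%:Z) - sigma x k) + (sigma x k - sigma x0 k)); last first.
    by rewrite addrA subrK.
  rewrite mulrDl; over.
rewrite big_split /= -!mulr_sumr addrC; apply: le_trans (le_normcD _ _) _; apply: lerD.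
  rewrite !normcM normc_expi mul1r; apply: le_trans (ler_wpM2r (normc_ge0 _) hL) _.
  by rewrite -mulrA mulrC ler_wpM2r// dirichlet_chord.
apply: le_trans (normc_sum_le _ _) _.
apply: le_trans (_ : \sum_(j < N) N%:R * eta <= _); last first.
  by rewrite sumr_const card_ord -[leLHS]mulr_natl expr2 mulrA.
apply: ler_sum => j _; rewrite !normcM normc_expi normc_expiX !mulr1.
by apply: le_trans (hN j (ltn_ord j)) _; rewrite ler_wpM2r// ler_nat ltnW.
Qed.

(** The Dirichlet kernel with [N] terms centred at [x0], modulated to have
    frequencies [k, ..., k + N - 1]. *)
Definition test_vector x0 k N : L2torus R :=
  \sum_(j < N) expi (- x0) ^+ j *: expi_L2 R (k + j%:Z).

Lemma L2norm_test_vector x0 k N : L2norm (test_vector x0 k N) = Num.sqrt (pi *+ 2) * Num.sqrt N%:R.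
Proof.
have pi0 : 0 <= pi *+ 2 :> R by rewrite mulrn_wge0// pi_ge0.
apply/eqP; rewrite -(@eqrXn2 _ 2)// ?L2norm_ge0 ?mulr_ge0 ?sqrtr_ge0//; apply/eqP.
rewrite exprMn !sqr_sqrtr// (@L2norm_lincomb _ _ _ (fun j : 'I_N => k + j%:Z)).
  by under eq_bigr do rewrite normc_expiX expr1n; rewrite sumr_const card_ord.
by move=> i j /addrI [] /val_inj.
Qed.

Lemma test_vector_eigen sigma (T : {linear L2torus R -> L2torus R}) L eta N k x0 :
  extends_pdo sigma T -> 0 <= L -> 0 <= eta ->
  (forall x, x \in `[- pi, pi] -> normc (sigma x k - sigma x0 k) <= L * normc (1 - expi (x - x0))) ->
  (forall x j, (j < N)%N -> normc (sigma x (k + j%:Z) - sigma x k) <= j%:R * eta) ->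
  L2norm (T (test_vector x0 k N) - sigma x0 k *: test_vector x0 k N) <=
  (2 * L + N%:R ^+ 2 * eta) * Num.sqrt (pi *+ 2).
Proof.
move=> hT L0 eta0 hL hN.
apply: L2norm_le_sup; first by rewrite addr_ge0 ?mulr_ge0 ?sqr_ge0.
pose c := sigma x0 k.
have -> : T (test_vector x0 k N) - c *: test_vector x0 k N =
    \sum_(j < N) expi (- x0) ^+ j *: (T (expi_L2 R (k + j%:Z)) - c *: expi_L2 R (k + j%:Z)).
  rewrite /test_vector linear_sum scaler_sumr -sumrB; apply: eq_bigr => j _.
  by rewrite linearZ scalerBr !scalerA mulrC.
have eae m : (T (expi_L2 R m) - c *: expi_L2 R m : L2torus R) =
    (fun x => (sigma x m - c) * expi_fun m x) %[ae mu].
  rewrite -scaleNr.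
  have h1 := L2torusD_ae (T (expi_L2 R m)) (- c *: expi_L2 R m).
  have h2 := L2torusZ_ae (- c) (expi_L2 R m).
  apply: filterS2 (filterI h1 h2) (filterI (expi_L2_ae R m) (pdo_expi_L2 m hT)).
  by move=> x [e1 e2] [e3 e4] _; rewrite e1// e2// e3// e4// mulrDl mulNr.
have h := L2torus_lincomb_ae (index_enum 'I_N) (fun j : 'I_N => expi (- x0) ^+ j)
  (fun j => eae (k + j%:Z)).
have := @ae_torus (fun x => x \in `[- pi, pi]) (fun _ => id).
apply: filterS2 h => x /(_ I) -> xI.
exact: dirichlet_symbol_error (hL x xI) (hN x).
Qed.

Lemma operator_norm_ge (A : L2torus R -> L2torus R) r u : scalable A ->
  operator_norm A = r%:E -> L2norm (A u) <= r * L2norm u.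
Proof.
move=> AZ Ar; have [u0|u0] := eqVneq (L2norm u) 0.
  by rewrite (L2norm_eq0 u0) -(scale0r 0) AZ !L2normZ normc0 !mul0r mulr0.
have ugt0 : 0 < L2norm u by rewrite lt_def u0 L2norm_ge0.
have : ((L2norm (A ((L2norm u)^-1%:C *: u)))%:E <= operator_norm A)%E.
  apply: ereal_sup_ubound; exists ((L2norm u)^-1%:C *: u) => //=.
  by rewrite L2normZ normcR ger0_norm ?invr_ge0 ?L2norm_ge0// mulVf.
rewrite Ar lee_fin AZ L2normZ normcR ger0_norm ?invr_ge0 ?L2norm_ge0//.
by rewrite ler_pdivrMl// mulrC.
Qed.

Lemma leq_absz_shift (a b : nat) k (j : nat) :
  (a + b <= `|k|)%N -> (j < b)%N -> (a <= absz (k + j%:Z)%R)%N.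
Proof. by lia. Qed.

Lemma limsup_symbol_gt sigma (d : R) : (d%:E < limsup_symbol sigma)%E ->
  forall N : nat, exists k x, [/\ (N <= `|k|)%N, x \in `[- pi, pi] & d < normc (sigma x k)].
Proof.
move=> hd N.
have : (d%:E < ereal_sup [set ereal_sup [set (normc (sigma x k))%:E | x in `[(- pi)%R, pi]] |
    k in [set k : int | (N <= `|k|)%N]])%E.
  by apply: lt_le_trans hd _; apply: ereal_inf_lbound; exists N.
move=> /ereal_sup_gt[_ [k Nk <-]] /ereal_sup_gt[_ [x xI <-]].
by rewrite lte_fin => h; exists k, x.
Qed.

End eigenvector.

Unset Implicit Arguments.

Theorem theorem4p5 (R : realType) (Lam : int -> R) (mu rho : R)
    (hLam : weight_function Lam mu) (hrho : 0 < rho <= mu^-1)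
    (sigma : R -> int -> R[i]) (hsigma : symbol_M Lam rho 0 sigma)
    (T : {linear L2torus R -> L2torus R}) (hT : bounded_operator T)
    (hTsigma : extends_pdo sigma T)
    (K : {linear L2torus R -> L2torus R}) (hK : compact_operator K) :
  (limsup_symbol sigma <= operator_norm (T \- K)%R)%E.
Proof.
rewrite leNgt; apply/negP => lt.
have op0 : (0%:E <= operator_norm (T \- K)%R)%E.
  have n0 : L2norm (0 : L2torus R) = 0 by rewrite -(scale0r 0) L2normZ normc0 mul0r.
  apply: ereal_sup_ubound; exists 0; first by rewrite /= n0.
  by rewrite linear0 n0.
have [r opr] : exists r : R, operator_norm (T \- K)%R = r%:E.
  by move: op0 lt; case: (operator_norm _) => [r _ _|_|//]; [exists r|rewrite ltNge leey].
have [d [rd hd]] : exists d : R, r < d /\ (d%:E < limsup_symbol sigma)%E.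
  move: lt; rewrite opr; case: (limsup_symbol sigma) => [l|_|//].
    rewrite lte_fin => /midf_lt[rm ml]; exists ((r + l) / 2).
    by rewrite lte_fin.
  by exists (r + 1); rewrite ltrDl ltr01 ltry.
have hS := symbol_M_S hsigma.
have rho0 : 0 < rho by case/andP: hrho.
have [L L0 hL] := symbol_chord hS.
(* A test vector with [N = n ^ 2] terms has norm [s2 * n], while the three error
   terms add up to at most [(2 * L + 2) * s2]: [2 * L] from the Dirichlet kernel,
   [1] from the variation in [k] and [1] from [K]. *)
set s2 := Num.sqrt (pi *+ 2) : R.
have s20 : 0 < s2 by rewrite sqrtr_gt0 mulrn_wgt0// pi_gt0.
have [n hn] : exists n : nat, (2 * L + 2) / (d - r) < n%:R.
  by exists (Num.truncn ((2 * L + 2) / (d - r))).+1; rewrite truncnS_gt.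
have n0 : (0 < n)%N.
  rewrite -(ltr0n R); apply: le_lt_trans hn; apply: divr_ge0.
    by rewrite addr_ge0 ?mulr_ge0 ?(ltW L0).
  by rewrite subr_ge0 ltW.
pose N := (n ^ 2)%N.
have N0 : 0 < N%:R :> R by rewrite ltr0n expn_gt0 n0.
pose eta : R := (N%:R ^+ 2)^-1.
have eta0 : 0 < eta by rewrite invr_gt0 exprn_gt0.
have [N1 hN1] := symbol_slow hLam rho0 hS eta0.
have [N2 hN2] := compact_operator_expi hK (divr_gt0 s20 N0).
have [k [x0 [Nk x0I dx0]]] := limsup_symbol_gt hd (N1 + N2 + N)%N.
pose u := test_vector x0 k N.
have Tu : L2norm (T u - sigma x0 k *: u) <= (2 * L + 1) * s2.
  have Neta : N%:R ^+ 2 * eta = 1 by rewrite mulfV// gt_eqF// exprn_gt0.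
  rewrite -[X in 2 * L + X]Neta.
  apply: test_vector_eigen => //; [exact: ltW|exact: ltW| |].
    by move=> x xI; exact: hL.
  by move=> x j jN; apply: (symbol_slow_iter hN1); apply: leq_trans Nk; rewrite -addnA leq_add2l;
    apply: leq_trans (ltnW jN) (leq_addl _ _).
have Ku : L2norm (K u) <= s2.
  rewrite /u /test_vector linear_sum; apply: le_trans (L2norm_sum _ _) _.
  apply: le_trans (_ : \sum_(j < N) s2 / N%:R <= _).
    apply: ler_sum => j _; rewrite linearZ L2normZ normc_expiX mul1r ltW//.
    by apply/hN2/(leq_absz_shift _ (ltn_ord j)); apply: leq_trans Nk; rewrite leq_add2r leq_addl.
  by rewrite sumr_const card_ord -[X in X <= _]mulr_natr divfK// gt_eqF.
have uE : L2norm u = s2 * n%:R.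
  by rewrite L2norm_test_vector natrX sqrtr_sqr normr_nat.
have Au : L2norm (T u - K u) <= r * L2norm u.
  apply: (operator_norm_ge (A := (T \- K)%R)) => //.
  by move=> a v; rewrite linearZ.
have tri : normc (sigma x0 k) * L2norm u <=
    L2norm (T u - K u) + L2norm (K u) + L2norm (T u - sigma x0 k *: u).
  have e : sigma x0 k *: u = (T u - K u + K u) - (T u - sigma x0 k *: u).
    by rewrite subrK opprB addrC subrK.
  rewrite -L2normZ {1}e; apply: le_trans (L2normD _ _) _; rewrite L2normN lerD2r.
  exact: L2normD.
have : (2 * L + 2) * s2 < (d - r) * L2norm u.
  by rewrite uE mulrCA [ltLHS]mulrC ltr_pM2l// -ltr_pdivrMl ?subr_gt0// mulrC.
apply/negP; rewrite -leNgt mulrBl lerBlDl.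
apply: le_trans (_ : normc (sigma x0 k) * L2norm u <= _).
  by rewrite ler_wpM2r ?L2norm_ge0// ltW.
rewrite (_ : (2 * L + 2) * s2 = s2 + (2 * L + 1) * s2); last by ring.
by rewrite addrA; apply: le_trans tri _; apply: lerD => //; exact: lerD.
Qed.
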